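(* Let $X$ be a smooth complex projective variety of dimension $n$, let $R=\mathbb Z,\mathbb Q,\mathbb R$, or $\mathbb F_\ell$ ($\ell$ prime), with coefficients understood in the derived spectrum-level sense, and let $x_i\in L_{p_i}H_{k_i}(X;R)$ for $i=1,2,3$. If $x_1\bullet x_2=0$ and $x_2\bullet x_3=0$, there is a natural triple Lawson--Massey bracket $$\langle x_1,x_2,x_3\rangle_L\subset L_{p_1+p_2+p_3-2n}H_{k_1+k_2+k_3-4n+1}(X;R).$$ It is a coset of the subgroup $$I_L=x_1\bullet L_{p_2+p_3-n}H_{k_2+k_3-2n+1}(X;R)+L_{p_1+p_2-n}H_{k_1+k_2-2n+1}(X;R)\bullet x_3 .$$ The assertion is an operation on ordinary Lawson groups when all displayed cycle indices ($p_1+p_2+p_3-2n$, $p_2+p_3-n$, $p_1+p_2-n$) are nonnegative; the corresponding morphic operation $\langle D_X^{-1}x_1,D_X^{-1}x_2,D_X^{-1}x_3\rangle_{\mathrm{mor}}$ remains defined beyond that range.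
   Context: For a complex projective variety $X$, $\mathcal Z_p(X)$ is the topological abelian group of algebraic $p$-cycles and Lawson homology is $L_pH_k(X)=\pi_{k-2p}\mathcal Z_p(X)$ for $k\ge 2p\ge 0$. Derived coefficients: let $\mathbf L_p(X)$ be the connective $H\mathbb Z$-module spectrum attached (Dold--Kan) to the simplicial abelian group $\mathrm{Sing}_\bullet\mathcal Z_p(X)$, so $\pi_j\mathbf L_p(X)=\pi_j\mathcal Z_p(X)$; then $L_pH_k(X;R)=\pi_{k-2p}(\mathbf L_p(X)\wedge^{\mathbf L}_{H\mathbb Z}HR)$. For smooth quasi-projective $V$ over $\mathbb C$, $L^qH^m(V;\mathbb Z)$ is Friedlander--Lawson morphic cohomology, represented in $\mathrm{SH}(\mathbb C)$ by Heller's commutative motivic ring spectrum $\mathsf M\mathbb Z^{\mathrm{sst}}$: $L^qH^m(V;\mathbb Z)=[\Sigma^\infty V_+,\Sigma^{m,q}\mathsf M\mathbb Z^{\mathrm{sst}}]$. The mapping spectra $\mathcal A_V(q)=\mathrm{Map}(\Sigma^\infty V_+,\Sigma^{0,q}\mathsf M\mathbb Z^{\mathrm{sst}})$, $q\ge 0$, form a weight-graded associative $H\mathbb Z$-algebra, with an associative weight-graded differential graded $\mathbb Z$-algebra model $\mathcal C_V$, $H^m(\mathcal C_V(q))\cong L^qH^m(V;\mathbb Z)$. Coefficients: $L^qH^m(V;R)=\pi_{-m}(\mathcal A_V(q)\wedge^{\mathbf L}_{H\mathbb Z}HR)$, modelled by the derived extension of $\mathcal C_V$ to $R$. For $V=X$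 smooth projective of dimension $n$, Friedlander--Lawson duality is the isomorphism $D_X:L^qH^m(X;R)\to L_{n-q}H_{2n-m}(X;R)$ (in the ordinary Lawson range), and the Lawson intersection product is $x\bullet y=D_X(D_X^{-1}x\cdot D_X^{-1}y)$, mapping $L_pH_k\otimes L_{p'}H_{k'}$ to $L_{p+p'-n}H_{k+k'-2n}$. Morphic bracket: for $a_i\in L^{q_i}H^{m_i}(V;R)$ with $a_1a_2=a_2a_3=0$, choose closed representatives $A_i$ and cochains $U,U'$ with $dU=A_1A_2$, $dU'=A_2A_3$; $\langle a_1,a_2,a_3\rangle_{\mathrm{mor}}\subset L^{q_1+q_2+q_3}H^{m_1+m_2+m_3-1}(V;R)$ is the set of all classes of the cocycles $A_1U'+(-1)^{m_1+1}UA_3$ (equivalently, the Toda bracket in the multiplicative spectrum). The Lawson bracket is $\langle x_1,x_2,x_3\rangle_L=D_X\langle D_X^{-1}x_1,D_X^{-1}x_2,D_X^{-1}x_3\rangle_{\mathrm{mor}}$. ''Natural'' means that for multiplicative maps of the models, in particular pullback $f^*$ along a morphism of smooth varieties, $f^*\langle a_1,a_2,a_3\rangle_{\mathrm{mor}}\subseteq\langle f^*a_1,f^*a_2,f^*a_3\rangle_{\mathrm{mor}}$. *)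

(* Defs.v *)
(* The notations of multinomials clash with those of MathComp-Analysis: only
   its constants and instances are imported. *)
From HB Require Import structures.
From mathcomp Require Import -(notations) mpoly freeg.
From mathcomp Require Import all_boot all_order all_algebra.
From mathcomp Require Import complex.
From mathcomp Require Import all_classical all_reals topology normedtype.

Set Implicit Arguments.
Unset Strict Implicit.
Unset Printing Implicit Defensive.

Import Order.TTheory GRing.Theory Num.Theory.
Import numFieldNormedType.Exports.

Local Open Scope classical_set_scope.
Local Open Scope ring_scope.

Definition is_subgroup (A : zmodType) (S : set A) : Prop :=
  S 0 /\ forall x y, S x -> S y -> S (x - y).

Record subgroup (A : zmodType) := Subgroup {
  sg_set :> A -> Prop;
  sg_subgroup : is_subgroup sg_set }.

Definition gen_set (A : zmodType) (S : set A) : set A :=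
  [set x | forall T, is_subgroup T -> S `<=` T -> T x].

Lemma gen_setP (A : zmodType) (S : set A) : is_subgroup (gen_set S).
Proof.
split=> [T [T0 _] _ //|x y Gx Gy T HT ST].
by case: (HT) => _; apply; [exact: Gx|exact: Gy].
Qed.

Definition gen (A : zmodType) (S : set A) : subgroup A := Subgroup (gen_setP S).

Section SubgroupTheory.
Variables (A : zmodType) (S : subgroup A).

Lemma sg0 : S 0. Proof. by case: S => /= T []. Qed.
Lemma sgB x y : S x -> S y -> S (x - y). Proof. by case: S => /= T [_]; apply. Qed.
Lemma sgN x : S x -> S (- x). Proof. by rewrite -sub0r => /(sgB sg0). Qed.
Lemma sgD x y : S x -> S y -> S (x + y).
Proof. by move=> Sx /sgN Sy; rewrite -[y]opprK; exact: sgB. Qed.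
End SubgroupTheory.

(* The group Z / (Z :&: B).  Its elements are canonical representatives. *)
Section Subquotient.
Variables (A : zmodType) (Z B : subgroup A).

Definition sq_coset (x : A) : set A := [set y | Z y /\ B (y - x)].
Definition sq_canon (x : A) : A := get (sq_coset x).

Lemma sq_coset_refl x : Z x -> sq_coset x x.
Proof. by move=> Zx; split=> //; rewrite subrr; exact: sg0. Qed.

Lemma sq_canonP x : Z x -> sq_coset x (sq_canon x).
Proof. by move=> /sq_coset_refl Hx; exact: (getI Hx). Qed.

Lemma sq_canon_eq x y : B (x - y) -> sq_canon x = sq_canon y.
Proof.
move=> Bxy; rewrite /sq_canon; congr get; apply/seteqP.
split=> z [Zz Bz]; split=> //.
  by rewrite -(subrK x z) -addrA; exact: sgD.
by rewrite -(subrK y z) -addrA; apply: sgD => //; rewrite -opprB; exact: sgN.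
Qed.

Definition subquot := {x : A | `[< Z x /\ sq_canon x = x >]}.
HB.instance Definition _ := Choice.on subquot.

Definition rep (c : subquot) : A := sval c.

Lemma rep_in c : Z (rep c).
Proof. by case: c => x /= /asboolP[]. Qed.

Lemma rep_canon c : sq_canon (rep c) = rep c.
Proof. by case: c => x /= /asboolP[]. Qed.

Lemma sq_mk_subproof x :
  `[< Z (sq_canon (if `[< Z x >] then x else 0)) /\
      sq_canon (sq_canon (if `[< Z x >] then x else 0))
      = sq_canon (if `[< Z x >] then x else 0) >].
Proof.
set y := if _ then _ else _.
have Zy : Z y by rewrite /y; case: asboolP => // _; exact: sg0.
have [Zc Bc] := sq_canonP Zy.
by apply/asboolP; split=> //; exact: sq_canon_eq.
Qed.

(* The class of x, for x in Z; by convention 0 outside Z. *)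
Definition cls (x : A) : subquot :=
  exist (fun y => `[< Z y /\ sq_canon y = y >]) _ (sq_mk_subproof x).

Lemma rep_cls x : Z x -> B (rep (cls x) - x).
Proof.
by move=> Zx; rewrite /rep /= asboolT //; case: (sq_canonP Zx).
Qed.

Lemma repK c : cls (rep c) = c.
Proof.
by apply: val_inj; rewrite /= asboolT ?rep_canon //; exact: rep_in.
Qed.

Lemma cls_eq x y : Z x -> Z y -> B (x - y) -> cls x = cls y.
Proof. by move=> Zx Zy Bxy; apply: val_inj; rewrite /= !asboolT //; exact: sq_canon_eq. Qed.

Definition sq_add c1 c2 := cls (rep c1 + rep c2).
Definition sq_opp c := cls (- rep c).

Lemma sq_addC : commutative sq_add.
Proof. by move=> a b; rewrite /sq_add addrC. Qed.

Lemma cls_add x y : Z x -> Z y -> sq_add (cls x) (cls y) = cls (x + y).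
Proof.
move=> Zx Zy; apply: cls_eq; [by apply: sgD; exact: rep_in|exact: sgD|].
by rewrite opprD addrACA; apply: sgD; exact: rep_cls.
Qed.

Lemma sq_addA : associative sq_add.
Proof.
move=> a b c; rewrite -(repK a) -(repK b) -(repK c).
by rewrite !cls_add ?addrA //; first [exact: rep_in | by apply: sgD; exact: rep_in].
Qed.

Lemma sq_add0 : left_id (cls 0) sq_add.
Proof. by move=> a; rewrite -(repK a) cls_add ?add0r //; [exact: sg0|exact: rep_in]. Qed.

Lemma sq_addN : left_inverse (cls 0) sq_opp sq_add.
Proof.
move=> a; rewrite -[a in sq_add _ a]repK /sq_opp cls_add ?addNr //.
  by apply: sgN; exact: rep_in.
exact: rep_in.
Qed.

HB.instance Definition _ :=
  GRing.isZmodule.Build subquot sq_addA sq_addC sq_add0 sq_addN.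

End Subquotient.

Arguments cls {A Z B} x.
Arguments rep {A Z B} c.
Notation "Z '///' B" := (@subquot _ Z B) (at level 40) : type_scope.

Definition ext0 (T : nat -> zmodType) (j : int) : zmodType :=
  match j with Posz i => T i | Negz _ => 'rV[int]_0 end.

Definition Zfree (K : choiceType) : zmodType :=
  FreegDefs.type_of (Phant int) (Phant K).

Definition basis (K : choiceType) (x : K) : Zfree K := @Freeg int K [:: (1, x)].

Definition Zlift (K : choiceType) (M : zmodType) (f : K -> M) (D : Zfree K) : M :=
  \sum_(x <- @dom int K D) f x *~ @coeff int K x D.

Definition Zmap (K L : choiceType) (f : K -> L) : Zfree K -> Zfree L :=
  Zlift (fun x => basis (f x)).

(* For chain groups Q_k `<=` P_k inside ambient groups A_k, this is the
   homology of (P / Q) (x) M, the tensor product being presented by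
   generators p (x) m and relations (so cycles are taken modulo tens_rel).  When P / Q is torsion free (as it is for
   all singular complexes below) this is the derived tensor product. *)
Section Homology.
Variables (A : nat -> zmodType) (bd : forall k, A k.+1 -> A k).
Variables (P Q : forall k, set (A k)) (M : zmodType).

Definition tens k : choiceType := (A k * M)%type.

Definition tens_chain k : subgroup (Zfree (tens k)) :=
  gen [set z | exists2 x : A k, P x & exists m : M, z = basis ((x, m) : tens k)].

Definition tens_rel k : subgroup (Zfree (tens k)) :=
  gen [set z |
    [\/ exists x y : A k, exists m : M, P x /\ P y /\
          z = basis ((x + y, m) : tens k) - basis ((x, m) : tens k)
              - basis ((y, m) : tens k),
        exists x : A k, exists m m' : M, P x /\
          z = basis ((x, m + m') : tens k) - basis ((x, m) : tens k)
              - basis ((x, m') : tens k)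
      | exists x : A k, exists m : M, Q x /\ z = basis ((x, m) : tens k)]].

Definition tens_bd k : Zfree (tens k.+1) -> Zfree (tens k) :=
  Zmap (fun xm : tens k.+1 => (bd xm.1, xm.2) : tens k).

Definition is_tens_cycle k : Zfree (tens k) -> Prop :=
  match k with
  | 0 => fun _ => True
  | k'.+1 => fun z => tens_rel k' (tens_bd z)
  end.

Definition tens_cycle k : subgroup (Zfree (tens k)) :=
  gen [set z | tens_chain k z /\ is_tens_cycle z].

Definition tens_boundary k : subgroup (Zfree (tens k)) :=
  gen (tens_rel k `|` (@tens_bd k @` sg_set (tens_chain k.+1))).

Definition homology k : zmodType := tens_cycle k /// tens_boundary k.

End Homology.

Inductive coefficients :=
  CoefZ | CoefQ | CoefR | CoefF (l : nat) of prime l.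

Definition coef_ring (R : realType) (c : coefficients) : comNzRingType :=
  match c with
  | CoefZ => int
  | CoefQ => rat
  | CoefR => R
  | CoefF l _ => 'F_l
  end.

Section Geometry.
Variable R : realType.
Local Notation C := R[i].

(* Points of the projective space P^(r-1) are non-zero vectors of C^r up to
   scaling; a subset of P^(r-1) is represented by the cone without apex over
   it. *)
Definition vec r := 'rV[C]_r.
Definition poly_at r (F : mpoly r C) (v : vec r) : C := meval (fun i => v 0 i) F.
Definition homogeneous r (F : mpoly r C) : Prop :=
  exists d, F \is @ishomog1 r C d mdeg.

Definition zeros r (S : set (mpoly r C)) : set (vec r) :=
  [set v | v != 0 /\ forall F, S F -> poly_at F v = 0].

Definition zclosed r (V : set (vec r)) : Prop :=
  exists S : set (mpoly r C), (forall F, S F -> homogeneous F) /\ V = zeros S.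

Definition vanishing r (V : set (vec r)) : set (mpoly r C) :=
  [set F | homogeneous F /\ forall v, V v -> poly_at F v = 0].

Definition zclosure r (V : set (vec r)) : set (vec r) := zeros (vanishing V).

Definition zirreducible r (V : set (vec r)) : Prop :=
  V !=set0 /\ forall A B : set (vec r), zclosed A -> zclosed B ->
    V `<=` A `|` B -> V `<=` A \/ V `<=` B.

Definition subvariety r (V : set (vec r)) : Prop := zclosed V /\ zirreducible V.

Definition has_chain r (V : set (vec r)) (p : nat) : Prop :=
  exists W : nat -> set (vec r),
    (forall i, (i <= p)%N -> subvariety (W i) /\ W i `<=` V) /\
    (forall i, (i < p)%N -> W i `<` W i.+1).

Definition zdim r (V : set (vec r)) (p : nat) : Prop :=
  has_chain V p /\ ~ has_chain V p.+1.

Definition locally_closed r (V : set (vec r)) : Prop :=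
  exists A B : set (vec r), zclosed A /\ zclosed B /\ V = A `\` B.

(* Jacobian criterion at every point: r.-1 - n is the codimension. *)
Definition smooth_of_dim r (V : set (vec r)) (n : nat) : Prop :=
  zdim (zclosure V) n /\
  forall v, V v -> exists F : 'I_(r.-1 - n) -> mpoly r C,
    (forall i, vanishing V (F i)) /\
    row_free (\matrix_(i < r.-1 - n, j < r) poly_at (mderiv j (F i)) v).

(* Irreducible smooth quasi-projective varieties. *)
Record smooth_variety := SmoothVariety {
  sv_ambient : nat;
  sv_set : set (vec sv_ambient);
  sv_dim : nat;
  sv_loc_closed : locally_closed sv_set;
  sv_irreducible : zirreducible sv_set;
  sv_smooth : smooth_of_dim sv_set sv_dim }.

Arguments sv_set : clear implicits.

Definition projective (V : smooth_variety) : Prop := zclosed (sv_set V).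

(* A morphism is given by a choice of homogeneous coordinates of the image of
   each point, which is locally proportional to a tuple of homogeneous
   polynomials of the same degree. *)
Definition is_morphism (V W : smooth_variety)
    (f : vec (sv_ambient V) -> vec (sv_ambient W)) : Prop :=
  forall v, sv_set V v -> sv_set W (f v) /\
    exists d, exists G : 'I_(sv_ambient W) -> mpoly (sv_ambient V) C,
      let Gv w := \row_j poly_at (G j) w in
      [/\ forall j, G j \is @ishomog1 _ C d mdeg, Gv v != 0 &
          forall w, sv_set V w -> Gv w != 0 ->
            exists2 a : C, a != 0 & f w = a *: Gv w].

Definition same_morphism (V W : smooth_variety)
    (f g : vec (sv_ambient V) -> vec (sv_ambient W)) : Prop :=
  forall v, sv_set V v -> exists2 a : C, a != 0 & f v = a *: g v.

Definition segre r s (u : vec r) (v : vec s) : vec (r * s) := mxvec (u^T *m v).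

Definition zprod r s (V : set (vec r)) (W : set (vec s)) : set (vec (r * s)) :=
  [set w | exists2 u, V u & exists2 v, W v & w = segre u v].

Definition Pspace q : set (vec q.+1) := [set v | v != 0].
Definition Phyper q : set (vec q.+1) := [set v | v != 0 /\ v 0 ord0 = 0].

Definition cycle r : zmodType := Zfree (set (vec r)).
Definition mult r (V : set (vec r)) (c : cycle r) : int := @coeff int _ V c.
Definition components r (c : cycle r) : seq (set (vec r)) := @dom int _ c.

(* Chow (Cayley) form of a subvariety of dimension p: the irreducible
   polynomial in p.+1 linear forms (the rows of u) which vanishes exactly when
   the p.+1 hyperplanes have a common point on V. *)
Definition chow_form_of p r (V : set (vec r)) (F : mpoly (p.+1 * r) C) : Prop :=
  [/\ (1 < msize F)%N,
      forall G H, F = G * H -> (msize G <= 1)%N \/ (msize H <= 1)%N &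
      forall u : 'M[C]_(p.+1, r), poly_at F (mxvec u) = 0 <->
        exists2 v : vec r, V v & u *m v^T = 0].

Definition chow_form p r (c : cycle r) (F : mpoly (p.+1 * r) C) : Prop :=
  exists Phi : set (vec r) -> mpoly (p.+1 * r) C,
    (forall V, V \in components c -> chow_form_of V (Phi V)) /\
    exists2 a : C, a != 0 &
      F = a *: \prod_(V <- components c) Phi V ^+ `|mult V c|%N.

Definition coef_close p r (e : C) (F G : mpoly (p.+1 * r) C) : Prop :=
  forall m, `|mcoeff m F - mcoeff m G| < e.

(* S is the set of allowed components: Zfree S is the group of cycles and its
   effective cycles form the monoid N[S]. *)
Section CycleSpace.
Variables (p r : nat) (S : set (set (vec r))).

Definition cycle_on (c : cycle r) : Prop := forall V, V \in components c -> S V.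

Definition effective_on (c : cycle r) : Prop :=
  cycle_on c /\ forall V, 0 <= mult V c.

(* Open sets of the naive group completion of the Chow monoid N[S]: the
   quotient topology for (a, b) |-> a - b, where N[S] carries the analytic
   topology given by coefficients of Chow forms up to scaling.  The Chow forms
   of cycles of different degrees have disjoint supports, so that distinct
   degrees lie in distinct components. *)
Definition cycle_open (W : set (cycle r)) : Prop :=
  forall (a b : cycle r) (F G : mpoly (p.+1 * r) C),
    effective_on a -> effective_on b -> chow_form a F -> chow_form b G ->
    W (a - b) ->
    exists2 e : C, 0 < e &
      forall (a' b' : cycle r) (F' G' : mpoly (p.+1 * r) C),
        effective_on a' -> effective_on b' ->
        chow_form a' F' -> chow_form b' G' ->
        coef_close e F' F -> coef_close e G' G -> W (a' - b').

Definition in_simplex k (t : 'rV[R]_k.+1) : Prop :=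
  (forall i, 0 <= t 0 i) /\ \sum_i t 0 i = 1.

Definition simplex k := {t : 'rV[R]_k.+1 | in_simplex t}.

Definition sing_ambient k : zmodType := (simplex k -> cycle r).

Definition is_singular k (f : sing_ambient k) : Prop :=
  (forall t, cycle_on (f t)) /\
  forall W : set (cycle r), cycle_open W ->
    exists2 O : set 'rV[R]_k.+1, open O &
      forall t : simplex k, W (f t) <-> O (sval t).

(* As the cycle space is a topological group, the continuous maps already form
   a group: gen adds nothing. *)
Definition Sing k : set (sing_ambient k) := sg_set (gen (@is_singular k)).

End CycleSpace.

Definition face_row k (i : 'I_k.+2) (t : 'rV[R]_k.+1) : 'rV[R]_k.+2 :=
  \row_j (if unlift i j is Some j' then t 0 j' else 0).

Lemma face_in_simplex k (i : 'I_k.+2) (t : simplex k) :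
  in_simplex (face_row i (sval t)).
Proof.
case: t => t [/= t0 t1]; split=> [j|].
  by rewrite mxE; case: unlift.
rewrite (bigD1_ord i) //= mxE unlift_none add0r -[RHS]t1.
by apply: eq_bigr => j _; rewrite mxE liftK.
Qed.

Definition face k (i : 'I_k.+2) (t : simplex k) : simplex k.+1 :=
  exist _ _ (face_in_simplex i t).

Definition sing_bd r k (f : sing_ambient r k.+1) : sing_ambient r k :=
  \sum_(i < k.+2) ((f \o face i) : sing_ambient r k) *~ ((-1) ^+ i).

(* H_j ((Sing Z[S] / Sing Z[S']) (x) M); take S' = set0 for the homotopy
   groups of Z[S] itself. *)
Definition sing_homology p r (S S' : set (set (vec r))) (M : zmodType) (j : nat)
    : zmodType :=
  homology (@sing_bd r) (Sing p S) (Sing p S') M j.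

Definition subvarieties r (X : set (vec r)) (p : nat) : set (set (vec r)) :=
  [set V | subvariety V /\ zdim V p /\ V `<=` X].

Definition lawson_nat r (X : set (vec r)) (p : nat) (M : zmodType) (j : nat) :
    zmodType :=
  sing_homology p (subvarieties X p) set0 M j.

(* L_p H_k (X; M), extended by 0 outside the range k >= 2p >= 0. *)
Definition lawson r (X : set (vec r)) (M : zmodType) (p k : int) : zmodType :=
  match p with
  | Posz p' => ext0 (lawson_nat X p' M) (k - p *+ 2)
  | Negz _ => 'rV[int]_0
  end.

(* The graphs of morphisms from X to the Chow monoids of 0-cycles on P^q are
   the effective n-cycles on X x P^q whose components are finite over X. *)
Definition finite_over r (X : set (vec r)) q (W : set (vec (r * q.+1))) : Prop :=
  forall x, X x -> exists s : seq (vec (r * q.+1)),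
    forall v, v != 0 -> W (segre x v) ->
      exists2 w, w \in s & exists a : C, segre x v = a *: w.

Definition cocycles r (X : set (vec r)) n q (Y : set (vec q.+1)) :
    set (set (vec (r * q.+1))) :=
  [set W | subvarieties (zprod X Y) n W /\ finite_over X W].

(* H_j of (Mor(X, C_0(P^q)) / Mor(X, C_0(P^(q-1))))^+ *)
Definition morphic_nat r (X : set (vec r)) n q (M : zmodType) (j : nat) :
    zmodType :=
  sing_homology n (cocycles X n (@Pspace q)) (cocycles X n (@Phyper q)) M j.

Definition morphic r (X : set (vec r)) n (M : zmodType) (q : nat) (m : int) :
    zmodType :=
  ext0 (morphic_nat X n q M) (q%:Z *+ 2 - m).

Definition cylinder r q : cycle r -> cycle (r * q.+1) :=
  Zmap (fun V => zprod V (@Pspace q)).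

(* Friedlander-Lawson duality: a in L^q H^(2q-j) corresponds to b in
   pi_j Z_p(X), p + q = n, when the class of the graph of a agrees with the
   flat pullback of b in the homology of
   Z_n(X x A^q) = Z_n(X x P^q) / Z_n(X x P^(q-1)). *)
Definition FL_corresponds r (X : set (vec r)) n q p (M : zmodType) (j : nat)
    (a : morphic_nat X n q M j) (b : lawson_nat X p M j) : Prop :=
  let pull : tens (sing_ambient r) M j -> tens (sing_ambient (r * q.+1)) M j :=
    fun fm => ((@cylinder r q \o fm.1 : sing_ambient _ j), fm.2) in
  tens_boundary (@sing_bd (r * q.+1))
    (Sing n (subvarieties (zprod X (@Pspace q)) n))
    (Sing n (subvarieties (zprod X (@Phyper q)) n)) M j
    (rep a - Zmap pull (rep b)).

End Geometry.

Arguments sv_set {R} s _.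

Definition sgnz (K : pzRingType) (m : int) : K := (-1) ^+ `|m|%N.

(* Internally graded: wd_gr q m is the piece of weight q and cohomological
   degree m of the total algebra. *)
Record wdga (K : comNzRingType) := WDGA {
  wd_alg :> algType K;
  wd_gr : nat -> int -> set wd_alg;
  wd_d : {linear wd_alg -> wd_alg};
  wd_gr_submod : forall q m, wd_gr q m 0 /\
    forall (a : K) x y, wd_gr q m x -> wd_gr q m y -> wd_gr q m (a *: x + y);
  wd_gr_span : forall x, exists (s : seq (nat * int)) (g : nat * int -> wd_alg),
    (forall i, wd_gr i.1 i.2 (g i)) /\ x = \sum_(i <- s) g i;
  wd_gr_indep : forall (s : seq (nat * int)) (g : nat * int -> wd_alg),
    uniq s -> (forall i, wd_gr i.1 i.2 (g i)) -> \sum_(i <- s) g i = 0 ->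
    forall i, i \in s -> g i = 0;
  wd_gr1 : wd_gr 0%N 0 1;
  wd_grM : forall q m q' m' x y, wd_gr q m x -> wd_gr q' m' y ->
    wd_gr (q + q')%N (m + m') (x * y);
  wd_d_gr : forall q m x, wd_gr q m x -> wd_gr q (m + 1) (wd_d x);
  wd_dd : forall x, wd_d (wd_d x) = 0;
  wd_leibniz : forall q m x y, wd_gr q m x ->
    wd_d (x * y) = wd_d x * y + sgnz wd_alg m * (x * wd_d y) }.

Definition is_wdga_map (K : comNzRingType) (A B : wdga K) (f : A -> B) : Prop :=
  [/\ linear f, monoid_morphism f,
      forall q m x, wd_gr q m x -> wd_gr q m (f x) &
      forall x, f (wd_d A x) = wd_d B (f x)].

Section Cohomology.
Variables (K : comNzRingType) (A : wdga K).

Definition cocycle_set q m : set A := [set x | wd_gr q m x /\ wd_d A x = 0].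
Definition cobound_set q m : set A := wd_d A @` wd_gr q (m - 1).

Lemma wd_grB q m (x y : A) : wd_gr q m x -> wd_gr q m y -> wd_gr q m (x - y).
Proof.
by move=> Hx Hy; rewrite addrC -scaleN1r; apply: (wd_gr_submod A q m).2.
Qed.

Lemma cocycle_setP q m : is_subgroup (cocycle_set q m).
Proof.
split=> [|x y [Hx dx] [Hy dy]].
  by split; [exact: (wd_gr_submod A q m).1|rewrite linear0].
by split; [exact: wd_grB|rewrite linearB /= dx dy subr0].
Qed.

Lemma cobound_setP q m : is_subgroup (cobound_set q m).
Proof.
split=> [|_ _ [x Hx <-] [y Hy <-]].
  by exists 0; [exact: (wd_gr_submod A q (m - 1)).1|rewrite linear0].
by exists (x - y); [exact: wd_grB|rewrite linearB].
Qed.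

Definition wd_cocycle q m := Subgroup (cocycle_setP q m).
Definition wd_cobound q m := Subgroup (cobound_setP q m).

Definition coh q m : zmodType := wd_cocycle q m /// wd_cobound q m.

(* The product H^m1(A(q1)) x H^m2(A(q2)) -> H^m(A(q)), where q = q1 + q2 and
   m = m1 + m2; the target index is left free to avoid casts along such
   equalities. *)
Definition coh_mul q1 m1 q2 m2 q m (a : coh q1 m1) (b : coh q2 m2) : coh q m :=
  cls (rep a * rep b).

(* The bracket lands in q = q1 + q2 + q3 and m = m1 + m2 + m3 - 1. *)
Definition mor_bracket q1 m1 q2 m2 q3 m3
    (a1 : coh q1 m1) (a2 : coh q2 m2) (a3 : coh q3 m3) :
    set (coh (q1 + q2 + q3) (m1 + m2 + m3 - 1)) :=
  [set c | exists A1 A2 A3 U U' : A,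
    [/\ wd_cocycle q1 m1 A1 /\ cls A1 = a1,
        wd_cocycle q2 m2 A2 /\ cls A2 = a2,
        wd_cocycle q3 m3 A3 /\ cls A3 = a3,
        (wd_gr (q1 + q2) (m1 + m2 - 1) U /\ wd_d A U = A1 * A2) /\
        (wd_gr (q2 + q3) (m2 + m3 - 1) U' /\ wd_d A U' = A2 * A3) &
        c = cls (A1 * U' + sgnz A (m1 + 1) * (U * A3))]].

Definition mor_indeterminacy q1 m1 q2 m2 q3 m3
    (a1 : coh q1 m1) (a3 : coh q3 m3) :
    set (coh (q1 + q2 + q3) (m1 + m2 + m3 - 1)) :=
  [set z | exists (b : coh (q2 + q3) (m2 + m3 - 1))
                  (b' : coh (q1 + q2) (m1 + m2 - 1)),
     z = coh_mul _ _ a1 b + coh_mul _ _ b' a3].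

End Cohomology.

Arguments coh_mul {K A q1 m1 q2 m2 q m} a b.
Arguments mor_indeterminacy {K A q1 m1} q2 m2 {q3 m3} a1 a3.

Definition coh_map (K : comNzRingType) (A B : wdga K) (f : A -> B) q m
    (a : coh A q m) : coh B q m := cls (f (rep a)).

Arguments coh_map {K A B} f {q m} a.

(* i : A -> B exhibits B as A (x)_Z K. *)
Definition is_base_change (K : comNzRingType) (A : wdga int) (B : wdga K)
    (i : A -> B) : Prop :=
  [/\ zmod_morphism i, monoid_morphism i,
      forall q m x, wd_gr q m x -> wd_gr q m (i x),
      forall x, i (wd_d A x) = wd_d B (i x) &
      forall (N : zmodType) (beta : A -> K -> N),
        (forall k, zmod_morphism (beta^~ k)) -> (forall x, zmod_morphism (beta x)) ->
        exists! g : B -> N,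
          zmod_morphism g /\ forall x k, g (k *: i x) = beta x k].

Definition coef_change (R : realType) r n q (X : set (vec R r))
    (K : comNzRingType) j (a : morphic_nat X n q int j) : morphic_nat X n q K j :=
  cls (Zmap (fun fm : tens (sing_ambient R (r * q.+1)) int j =>
               (fm.1, fm.2%:~R) : tens (sing_ambient R (r * q.+1)) K j) (rep a)).

(* A functorial weight-graded dg model V |-> C_V of morphic cohomology on
   smooth quasi-projective varieties, together with its derived extension to
   the coefficient ring K.  The integral model is flat, so the derived
   extension is the ordinary base change. *)
Record morphic_model (R : realType) (K : comNzRingType) := MorphicModel {
  mm_int : smooth_variety R -> wdga int;
  mm_flat : forall V (x : mm_int V) (l : nat), (0 < l)%N -> x *+ l = 0 -> x = 0;
  mm_coef :> smooth_variety R -> wdga K;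
  mm_ext : forall V, mm_int V -> mm_coef V;
  mm_extP : forall V, is_base_change (@mm_ext V);
  mm_pull_int : forall V W : smooth_variety R,
    (vec R (sv_ambient V) -> vec R (sv_ambient W)) -> mm_int W -> mm_int V;
  mm_pull : forall V W : smooth_variety R,
    (vec R (sv_ambient V) -> vec R (sv_ambient W)) -> mm_coef W -> mm_coef V;
  mm_pull_intP : forall (V W : smooth_variety R)
    (f : vec R (sv_ambient V) -> vec R (sv_ambient W)),
    is_morphism f -> is_wdga_map (mm_pull_int f);
  mm_pullP : forall (V W : smooth_variety R)
    (f : vec R (sv_ambient V) -> vec R (sv_ambient W)),
    is_morphism f -> is_wdga_map (mm_pull f);
  mm_pull_ext : forall (V W : smooth_variety R)
    (f : vec R (sv_ambient V) -> vec R (sv_ambient W)),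
    is_morphism f -> forall x,
    mm_pull f (mm_ext x) = mm_ext (mm_pull_int f x);
  mm_pull_eq : forall (V W : smooth_variety R)
    (f g : vec R (sv_ambient V) -> vec R (sv_ambient W)),
    is_morphism f -> is_morphism g ->
    same_morphism f g -> mm_pull_int f =1 mm_pull_int g;
  mm_pull_id : forall V : smooth_variety R, @mm_pull_int V V id =1 id;
  mm_pull_comp : forall U V W
    (f : vec R (sv_ambient U) -> vec R (sv_ambient V))
    (g : vec R (sv_ambient V) -> vec R (sv_ambient W)),
    is_morphism f -> is_morphism g ->
    @mm_pull_int U W (g \o f) =1 @mm_pull_int U V f \o @mm_pull_int V W g;
  mm_cmp_int : forall (X : smooth_variety R) q m,
    coh (mm_int X) q m -> morphic (sv_set X) (sv_dim X) int q m;
  mm_cmp : forall (X : smooth_variety R) q m,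
    coh (mm_coef X) q m -> morphic (sv_set X) (sv_dim X) K q m;
  mm_cmp_intP : forall (X : smooth_variety R) q m, projective X ->
    zmod_morphism (@mm_cmp_int X q m) /\ bijective (@mm_cmp_int X q m);
  mm_cmpP : forall (X : smooth_variety R) q m, projective X ->
    zmod_morphism (@mm_cmp X q m) /\ bijective (@mm_cmp X q m);
  mm_cmp_ext : forall (X : smooth_variety R) q m j (e : q%:Z *+ 2 - m = Posz j), projective X ->
    forall x, wd_cocycle (mm_int X) q m x ->
    let T (M : zmodType) := ext0 (morphic_nat (sv_set X) (sv_dim X) q M) in
    ecast i (T K i) e (mm_cmp (cls (mm_ext x))) =
    coef_change K (ecast i (T int i) e (mm_cmp_int (cls x))) }.

Arguments mm_pull {R K} m {V W} _ _ : rename.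
Arguments mm_pull_int {R K} m {V W} _ _ : rename.

Section Lawson.
Variables (R : realType) (K : comNzRingType) (M : morphic_model R K).
Variable X : smooth_variety R.
Local Notation n := (sv_dim X).
Local Notation L := (lawson (sv_set X) K).

(* D q m p k is used for p = n - q and k = 2n - m only. *)
Definition duality_type :=
  forall (q : nat) (m p k : int), coh (M X) q m -> L p k.

Definition is_FL_duality (D : duality_type) : Prop :=
  forall (q p : nat) (m k : int), (p + q)%N = n -> k = n%:Z *+ 2 - m ->
    [/\ zmod_morphism (D q m p k), bijective (D q m p k) &
        forall (j : nat) (e : q%:Z *+ 2 - m = Posz j) (e' : k - p%:Z *+ 2 = Posz j)
               (a : coh (M X) q m),
          FL_corresponds
            (ecast i (ext0 (morphic_nat (sv_set X) n q K) i) e (mm_cmp a))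
            (ecast i (ext0 (lawson_nat (sv_set X) p K) i) e' (D q m p k a))].

Variable D : duality_type.

Definition cowt (p : int) : nat := `|n%:Z - p|%N.
Definition codeg (k : int) : int := n%:Z *+ 2 - k.

Definition Dinv p k (x : L p k) : coh (M X) (cowt p) (codeg k) :=
  get [set a | D p k a = x].

(* The product of L_p1 H_k1 and L_p2 H_k2 lands in p = p1 + p2 - n and
   k = k1 + k2 - 2n; as for coh_mul the target index is left free. *)
Definition bullet p1 k1 p2 k2 p k (x : L p1 k1) (y : L p2 k2) : L p k :=
  D p k (coh_mul (Dinv x) (Dinv y)
         : coh (M X) (cowt p1 + cowt p2) (codeg k1 + codeg k2)).

Definition lawson_bracket p1 k1 p2 k2 p3 k3
    (x1 : L p1 k1) (x2 : L p2 k2) (x3 : L p3 k3) :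
    set (L (p1 + p2 + p3 - n%:Z *+ 2) (k1 + k2 + k3 - n%:Z *+ 4 + 1)) :=
  D _ _ @` mor_bracket (Dinv x1) (Dinv x2) (Dinv x3).

Definition lawson_indeterminacy p1 k1 p2 k2 p3 k3
    (x1 : L p1 k1) (x3 : L p3 k3) :
    set (L (p1 + p2 + p3 - n%:Z *+ 2) (k1 + k2 + k3 - n%:Z *+ 4 + 1)) :=
  [set z | exists (y : L (p2 + p3 - n%:Z) (k2 + k3 - n%:Z *+ 2 + 1))
                  (y' : L (p1 + p2 - n%:Z) (k1 + k2 - n%:Z *+ 2 + 1)),
     z = bullet _ _ x1 y + bullet _ _ y' x3].

End Lawson.

Arguments bullet {R K M X} D {p1 k1 p2 k2 p k} x y.
Arguments lawson_indeterminacy {R K M X} D {p1 k1} p2 k2 {p3 k3} x1 x3.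

(* The pullback D_Y o f^* o D_X^-1 for f : Y -> X; it maps L_p H_k(X) to
   L_p' H_k'(Y) with p' = p + n_Y - n_X and k' = k + 2 (n_Y - n_X). *)
Definition lawson_pull (R : realType) (K : comNzRingType)
    (M : morphic_model R K) (X Y : smooth_variety R)
    (DX : duality_type M X) (DY : duality_type M Y)
    (f : vec R (sv_ambient Y) -> vec R (sv_ambient X)) p k p' k'
    (x : lawson (sv_set X) K p k) : lawson (sv_set Y) K p' k' :=
  DY _ _ p' k' (coh_map (mm_pull M f) (Dinv DX x)).

Arguments lawson_pull {R K M X Y} DX DY f {p k} p' k' x.

Definition is_coset (A : zmodType) (I B : set A) : Prop :=
  is_subgroup I /\ exists y, B = [set y + i | i in I].

(* Main.v *)
Require Import Defs.
From mathcomp Require Import all_boot all_order all_algebra.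
From mathcomp Require Import all_classical all_reals.
From mathcomp Require Import zify.

Set Implicit Arguments.
Unset Strict Implicit.
Unset Printing Implicit Defensive.

Import Order.TTheory GRing.Theory Num.Theory.
Local Open Scope classical_set_scope.
Local Open Scope ring_scope.

(** The theorem is Massey's argument in the graded differential algebra that
models morphic cohomology, carried to Lawson homology by duality.

Fix cocycles A1, A2, A3.  Two nullhomotopies of A1 A2 differ by a cocycle, and
so do two nullhomotopies of A2 A3; hence the classes of
A1 U' + (-1)^(m1+1) U A3, for all U and U', form one coset of
a1 H + H a3 ([massey_coset]).  The bracket also lets the representatives vary.
Replacing one A_i by A_i + dE is compensated by moving U and U' by products of
E with the neighbouring cocycles, at the price of a coboundary:
[massey_classes1], [massey_classes2] and [massey_classes3] do this for one
factor at a time, and applied in turn they show that the representatives do not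
matter ([mor_bracket_rep]).  This gives the morphic statement
([mor_bracket_coset]).  A morphism of algebras carries A_i, U, U' to data of
the same kind, which is naturality ([mor_bracket_natural]).

On the Lawson side, the duality isomorphism is additive and bijective in every
bidegree with p + q = n and p >= 0.  In the stated range the bracket and both
products that make up the indeterminacy lie in such bidegrees, and the
Lawson products are by definition transported along the duality; so the image
of the morphic coset is a coset of the image subgroup, and this image is the
Lawson indeterminacy ([lawson_indeterminacyE], [lawson_bracket_coset]).

What remains is bookkeeping of indices.  The cohomology groups are families
indexed by a weight and a degree, and the two sides of an identity between
Lawson groups meet at indices that are equal without being convertible.  Two
classes at such indices are compared through their canonical representatives,
which live in the same algebra.  Identities between such classes are therefore
stated on [rep], and transported by [duality_reindex] and
[mor_bracket_reindex]. *)

(** * Classes in a subquotient *)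

Section Subquotients.
Variables (G : zmodType) (Z B : subgroup G).

Lemma clsD (x y : G) : Z x -> Z y -> cls x + cls y = cls (x + y) :> (Z /// B).
Proof. exact: cls_add. Qed.

Lemma clsN (x : G) : Z x -> - cls x = cls (- x) :> (Z /// B).
Proof.
move=> Zx; apply/esym/eqP; rewrite -addr_eq0 clsD //; last exact: sgN.
by rewrite addNr.
Qed.

Lemma clsB (x y : G) : Z x -> Z y -> cls x - cls y = cls (x - y) :> (Z /// B).
Proof. by move=> Zx Zy; rewrite clsN // clsD //; exact: sgN. Qed.

Lemma cls_eqP (x y : G) : Z x -> Z y ->
  cls x = cls y :> (Z /// B) <-> B (x - y).
Proof.
move=> Zx Zy; split=> [exy|]; last exact: cls_eq.
have /sgN := rep_cls B Zx; rewrite exy opprB => Bx.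
by have := sgD Bx (rep_cls B Zy); rewrite addrA subrK.
Qed.

Lemma cls_eq0 (x : G) : Z x -> cls x = 0 :> (Z /// B) <-> B x.
Proof. by move=> Zx; rewrite -[X in B X]subr0; apply: cls_eqP => //; exact: sg0. Qed.

End Subquotients.

(** * Koszul signs *)

Section Signs.
Variable K : pzRingType.

Lemma sgnzS (m : int) : sgnz K (m + 1) = - sgnz K m.
Proof.
rewrite /sgnz; case: m => m.
  by rewrite (_ : absz (Posz m + 1) = m.+1) ?exprS ?mulN1r //; lia.
rewrite (_ : absz (Negz m + 1) = m); last lia.
by rewrite (_ : absz (Negz m) = m.+1) // exprS mulN1r opprK.
Qed.

Lemma sgnz_pred (m : int) : sgnz K (m - 1) = - sgnz K m.
Proof. by rewrite -[in RHS](subrK 1 m) sgnzS opprK. Qed.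

Lemma sgnzD (m m' : int) : sgnz K (m + m') = sgnz K m * sgnz K m'.
Proof.
elim: m' => [|m' IH|m' IH]; first by rewrite addr0 /sgnz mulr1.
  by rewrite (_ : Posz m'.+1 = Posz m' + 1) ?addrA ?sgnzS ?IH ?mulrN //; lia.
rewrite (_ : - Posz m'.+1 = - Posz m' - 1); last lia.
by rewrite addrA !sgnz_pred IH mulrN.
Qed.

(** Case analysis on the value of a sign: products with it then simplify without
any commutativity in the algebra. *)
Variant sgnz_spec (m : int) : K -> Prop :=
  | SgnzPos of sgnz K m = 1 : sgnz_spec m 1
  | SgnzNeg of sgnz K m = -1 : sgnz_spec m (-1).

Lemma sgnzP (m : int) : sgnz_spec m (sgnz K m).
Proof.
have : sgnz K m = (-1) ^+ (odd `|m|%N) by rewrite signr_odd.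
by case: (odd _) => /= E; rewrite [X in sgnz_spec _ X]E; constructor.
Qed.

Lemma sg_sgnz (S : subgroup K) (m : int) (x : K) : S x -> S (sgnz K m * x).
Proof. by case: sgnzP => _ Sx; rewrite ?mul1r // mulN1r; exact: sgN. Qed.

End Signs.

(** * Products and Massey brackets in a graded differential algebra *)

Section Brackets.
Variables (K : comNzRingType) (A : wdga K).
Implicit Types (q : nat) (m : int) (x y E : A).

Local Notation d := (wd_d A).
Local Notation sg := (sgnz A).
Local Notation gr := (@wd_gr K A).

Lemma wd_grP q m : is_subgroup (gr q m).
Proof. by split=> [|x y]; [exact: (wd_gr_submod A q m).1|exact: wd_grB]. Qed.

Definition wd_piece q m := Subgroup (wd_grP q m).

(** The target indices are variables, so that sums of weights and degrees can be
regrouped in the side conditions. *)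
Lemma wd_grM_to q1 m1 q2 m2 q m x y : q = (q1 + q2)%N -> m = m1 + m2 ->
  gr q1 m1 x -> gr q2 m2 y -> wd_piece q m (x * y).
Proof. by move=> -> ->; exact: wd_grM. Qed.

Lemma wd_d_mull q m x y : gr q m x -> d x = 0 ->
  d (x * y) = sg m * (x * d y).
Proof. by move=> gx dx; rewrite (wd_leibniz _ gx) dx mul0r add0r. Qed.

Lemma wd_d_mulr q m x y : gr q m x -> d y = 0 -> d (x * y) = d x * y.
Proof. by move=> gx dy; rewrite (wd_leibniz _ gx) dy !mulr0 addr0. Qed.

Lemma wd_d_sg m x : d (sg m * x) = sg m * d x.
Proof. by case: sgnzP => _; rewrite ?mul1r // !mulN1r linearN. Qed.

Lemma sg_mulCA m x y : x * (sg m * y) = sg m * (x * y).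
Proof. by case: sgnzP => _; rewrite ?mul1r // !mulN1r mulrN. Qed.

Lemma sgK m x : sg m * (sg m * x) = x.
Proof. by case: sgnzP => _; rewrite ?mul1r // !mulN1r opprK. Qed.

Lemma sg_conj m m' x : sg m' * (sg m * sg m' * x) = sg m * x.
Proof.
by case: (sgnzP A m') => _; rewrite ?mulr1 ?mul1r // mulrN1 mulN1r mulNr opprK.
Qed.

Lemma wd_cocycleM q1 m1 q2 m2 q m x y : q = (q1 + q2)%N -> m = m1 + m2 ->
  wd_cocycle A q1 m1 x -> wd_cocycle A q2 m2 y -> wd_cocycle A q m (x * y).
Proof.
move=> -> -> [gx dx] [gy dy]; split; first exact: wd_grM.
by rewrite (wd_d_mull _ gx dx) dy !mulr0.
Qed.

Lemma wd_coboundMl q1 m1 q2 m2 q m x y : q = (q1 + q2)%N -> m = m1 + m2 ->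
  wd_cobound A q1 m1 x -> wd_cocycle A q2 m2 y -> wd_cobound A q m (x * y).
Proof.
move=> eq em [E gE <-] [gy dy]; exists (E * y).
  by apply: (wd_grM_to _ _ gE gy) => //; lia.
by rewrite (wd_d_mulr gE dy).
Qed.

Lemma wd_coboundMr q1 m1 q2 m2 q m x y : q = (q1 + q2)%N -> m = m1 + m2 ->
  wd_cocycle A q1 m1 x -> wd_cobound A q2 m2 y -> wd_cobound A q m (x * y).
Proof.
move=> eq em [gx dx] [E gE <-]; exists (sg m1 * (x * E)).
  by apply: (@sg_sgnz _ (wd_piece _ _)); apply: (wd_grM_to _ _ gx gE) => //; lia.
by rewrite wd_d_sg (wd_d_mull _ gx dx) sgK.
Qed.

Lemma wd_d_cocycle q m E : gr q (m - 1) E -> wd_cocycle A q m (d E).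
Proof.
by move=> gE; split; [rewrite -(subrK 1 m); exact: wd_d_gr|exact: wd_dd].
Qed.

(** The product of classes may be computed on any representatives, because
coboundaries form an ideal in the cocycles. *)
Lemma coh_mul_cls q1 m1 q2 m2 q m x y : q = (q1 + q2)%N -> m = m1 + m2 ->
  wd_cocycle A q1 m1 x -> wd_cocycle A q2 m2 y ->
  coh_mul (cls x : coh A q1 m1) (cls y : coh A q2 m2) = cls (x * y) :> coh A q m.
Proof.
move=> eq em Zx Zy; set a := cls x; set b := cls y.
have Za := rep_in a; have Zb := rep_in b.
apply: cls_eq; [exact: wd_cocycleM Za Zb|exact: wd_cocycleM Zx Zy|].
rewrite (_ : _ - _ = (rep a - x) * rep b + x * (rep b - y)); last first.
  by rewrite mulrBl mulrBr addrA subrK.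
by apply: sgD; [apply: wd_coboundMl (rep_cls _ Zx) Zb
               |apply: wd_coboundMr Zx (rep_cls _ Zy)].
Qed.

Section Additivity.
Variables (q1 q2 q : nat) (m1 m2 m : int).
Hypotheses (eq : q = (q1 + q2)%N) (em : m = m1 + m2).

Lemma coh_mulBr (a : coh A q1 m1) (b b' : coh A q2 m2) :
  coh_mul a (b - b') = coh_mul a b - coh_mul a b' :> coh A q m.
Proof.
have [Za [Zb Zb']] := (rep_in a, (rep_in b, rep_in b')).
rewrite -(repK a) -(repK b) -(repK b') clsB // !coh_mul_cls //; last exact: sgB.
by rewrite clsB ?mulrBr //; exact: (wd_cocycleM eq em).
Qed.

Lemma coh_mulBl (a a' : coh A q1 m1) (b : coh A q2 m2) :
  coh_mul (a - a') b = coh_mul a b - coh_mul a' b :> coh A q m.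
Proof.
have [Za [Za' Zb]] := (rep_in a, (rep_in a', rep_in b)).
rewrite -(repK a) -(repK a') -(repK b) clsB // !coh_mul_cls //; last exact: sgB.
by rewrite clsB ?mulrBl //; exact: (wd_cocycleM eq em).
Qed.

End Additivity.

Section Triple.
Variables (q1 q2 q3 : nat) (m1 m2 m3 : int).

Local Notation T := (coh A (q1 + q2 + q3) (m1 + m2 + m3 - 1)).
Local Notation Z1 := (wd_cocycle A q1 m1).
Local Notation Z2 := (wd_cocycle A q2 m2).
Local Notation Z3 := (wd_cocycle A q3 m3).
Local Notation ZT := (wd_cocycle A (q1 + q2 + q3) (m1 + m2 + m3 - 1)).

Definition left_null (A1 A2 U : A) :=
  gr (q1 + q2) (m1 + m2 - 1) U /\ d U = A1 * A2.
Definition right_null (A2 A3 U' : A) :=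
  gr (q2 + q3) (m2 + m3 - 1) U' /\ d U' = A2 * A3.
Definition massey_cochain (A1 A3 U U' : A) : A :=
  A1 * U' + sg (m1 + 1) * (U * A3).

(** The differential of the two terms is (-1)^m1 A1 A2 A3 and its opposite. *)
Lemma massey_cocycle (A1 A2 A3 U U' : A) : Z1 A1 -> Z3 A3 ->
  left_null A1 A2 U -> right_null A2 A3 U' -> ZT (massey_cochain A1 A3 U U').
Proof.
move=> [g1 d1] [g3 d3] [gU dU] [gU' dU']; split.
  apply: (@sgD _ (wd_piece _ _)); last apply: (@sg_sgnz _ (wd_piece _ _)).
    by apply: (wd_grM_to _ _ g1 gU'); lia.
  by apply: (wd_grM_to _ _ gU g3); lia.
rewrite linearD /= wd_d_sg (wd_d_mull _ g1 d1) (wd_d_mulr gU d3) dU dU' sgnzS.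
by rewrite mulNr mulrA subrr.
Qed.

(** The part of the bracket that comes from fixed representatives. *)
Definition massey_classes (A1 A2 A3 : A) : set T :=
  [set c | exists U U', [/\ left_null A1 A2 U, right_null A2 A3 U' &
                            c = cls (massey_cochain A1 A3 U U')]].

(** Moving the first cocycle by dE is undone by taking V - E A2 in place of V;
the two cochains then differ by d (E V'). *)
Lemma massey_classes1 (A1 A2 A3 E : A) :
  Z1 A1 -> Z2 A2 -> Z3 A3 -> gr q1 (m1 - 1) E ->
  massey_classes (A1 + d E) A2 A3 `<=` massey_classes A1 A2 A3.
Proof.
move=> Z1A Z2A Z3A gE _ [V [V' [nV nV' ->]]].
have nU : left_null A1 A2 (V - E * A2).
  case: nV Z2A => gV dV [g2 d2]; split.
    by apply: wd_grB => //; apply: (wd_grM_to _ _ gE g2) => //; lia.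
  by rewrite linearB /= (wd_d_mulr gE d2) dV mulrDl addrK.
have Z1E := sgD Z1A (wd_d_cocycle gE).
exists (V - E * A2), V'; split=> //; apply: cls_eq.
- exact: massey_cocycle nV nV'.
- exact: massey_cocycle nU nV'.
case: nV' => gV' dV'; exists (E * V').
  by apply: (wd_grM_to _ _ gE gV'); lia.
rewrite (wd_leibniz _ gE) dV' sgnz_pred /massey_cochain sgnzS mulrA; apply/esym/eqP.
rewrite subr_eq mulrDl mulrBl mulrBr addrACA [d E * _ + _]addrC.
by rewrite [X in _ == _ + X]addrCA subrr addr0.
Qed.

(** Moving the middle cocycle by dE changes both products, and the corrections
(-1)^m1 A1 E and E A3 contribute opposite multiples of A1 E A3: the cochain
itself does not change. *)
Lemma massey_classes2 (A1 A2 A3 E : A) :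
  Z1 A1 -> Z2 A2 -> Z3 A3 -> gr q2 (m2 - 1) E ->
  massey_classes A1 (A2 + d E) A3 `<=` massey_classes A1 A2 A3.
Proof.
move=> [g1 d1] Z2A [g3 d3] gE _ [V [V' [[gV dV] [gV' dV'] ->]]].
exists (V - sg m1 * (A1 * E)), (V' - E * A3); split.
- split; last first.
    by rewrite linearB /= wd_d_sg (wd_d_mull _ g1 d1) sgK dV mulrDr addrK.
  apply: wd_grB => //; apply: (@sg_sgnz _ (wd_piece _ _)).
  by apply: (wd_grM_to _ _ g1 gE) => //; lia.
- split; last by rewrite linearB /= (wd_d_mulr gE d3) dV' mulrDl addrK.
  by apply: wd_grB => //; apply: (wd_grM_to _ _ gE g3) => //; lia.
congr cls; rewrite /massey_cochain sgnzS mulrBl mulrBr mulrBr !mulNr.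
by rewrite -mulrA sgK opprK -mulrA addrACA addNr addr0.
Qed.

(** Mirror image of the first cocycle: V' - (-1)^m2 A2 E replaces V', and the
two cochains differ by (-1)^m2 d (V E). *)
Lemma massey_classes3 (A1 A2 A3 E : A) :
  Z1 A1 -> Z2 A2 -> Z3 A3 -> gr q3 (m3 - 1) E ->
  massey_classes A1 A2 (A3 + d E) `<=` massey_classes A1 A2 A3.
Proof.
move=> Z1A Z2A Z3A gE _ [V [V' [nV nV' ->]]].
have nU' : right_null A2 A3 (V' - sg m2 * (A2 * E)).
  case: nV' Z2A => gV' dV' [g2 d2]; split.
    apply: wd_grB => //; apply: (@sg_sgnz _ (wd_piece _ _)).
    by apply: (wd_grM_to _ _ g2 gE) => //; lia.
  by rewrite linearB /= wd_d_sg (wd_d_mull _ g2 d2) sgK dV' mulrDr addrK.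
have Z3E := sgD Z3A (wd_d_cocycle gE).
exists V, (V' - sg m2 * (A2 * E)); split=> //; apply: cls_eq.
- exact: massey_cocycle nV nV'.
- exact: massey_cocycle nV nU'.
case: nV => gV dV; exists (sg m2 * (V * E)).
  by apply: (@sg_sgnz _ (wd_piece _ _)); apply: (wd_grM_to _ _ gV gE); lia.
rewrite wd_d_sg (wd_leibniz _ gV) dV sgnz_pred sgnzD /massey_cochain sgnzS.
apply/esym/eqP; rewrite subr_eq !mulNr !mulrDr !mulrN sg_conj sg_mulCA !mulrA.
by rewrite opprD addrACA [X in _ == X + _]addrCA subrr addr0 [X in _ == _ + X]addrC.
Qed.

(** Nullhomotopies of a fixed product form a torsor under the cocycles of the same
degree.  Varying U' adds multiples of a1 to the class, and varying U adds
multiples of a3. *)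
Lemma massey_coset (A1 A2 A3 U U' : A) : Z1 A1 -> Z3 A3 ->
  left_null A1 A2 U -> right_null A2 A3 U' ->
  massey_classes A1 A2 A3 =
  [set cls (massey_cochain A1 A3 U U') + z
     | z in mor_indeterminacy q2 m2 (cls A1 : coh A q1 m1) (cls A3 : coh A q3 m3)].
Proof.
move=> Z1A Z3A nU nU'; have [[gU dU] [gU' dU']] := (nU, nU').
have q_assoc : (q1 + q2 + q3 = q1 + (q2 + q3))%N by lia.
have m_assocl : m1 + m2 + m3 - 1 = m1 + m2 - 1 + m3 by lia.
have m_assocr : m1 + m2 + m3 - 1 = m1 + (m2 + m3 - 1) by lia.
have ZU := massey_cocycle Z1A Z3A nU nU'.
apply/seteqP; split=> [_ [V [V' [nV nV' ->]]]|_ [_ [b [b' ->]] <-]].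
  have [[gV dV] [gV' dV']] := (nV, nV').
  have ZV := massey_cocycle Z1A Z3A nV nV'.
  have Zl : wd_cocycle A (q1 + q2) (m1 + m2 - 1) (sg (m1 + 1) * (V - U)).
    apply: sg_sgnz; split; first exact: wd_grB.
    by rewrite linearB /= dV dU subrr.
  have Zr : wd_cocycle A (q2 + q3) (m2 + m3 - 1) (V' - U').
    by split; [exact: wd_grB|rewrite linearB /= dV' dU' subrr].
  exists (cls (massey_cochain A1 A3 V V') - cls (massey_cochain A1 A3 U U')).
    exists (cls (V' - U')), (cls (sg (m1 + 1) * (V - U))).
    rewrite (coh_mul_cls q_assoc m_assocr) // (coh_mul_cls erefl m_assocl) //.
    rewrite clsB // clsD; last 2 first.
    - exact: (wd_cocycleM q_assoc m_assocr).
    - exact: (wd_cocycleM erefl m_assocl).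
    congr cls; rewrite /massey_cochain opprD addrACA -!mulrBr -mulrBl.
    by rewrite mulrA.
  by rewrite [LHS]addrC subrK.
rewrite -(repK b) -(repK b').
move: (rep b) (rep b') (rep_in b) (rep_in b') => {b b'} B B' ZB ZB'.
have [[gB dB] [gB' dB']] := (ZB, ZB').
(* The sign cancels the one in front of U A3 in the cochain. *)
exists (U + sg (m1 + 1) * B'), (U' + B); split.
- split; last by rewrite linearD /= wd_d_sg dB' mulr0 addr0.
  by apply: (@sgD _ (wd_piece _ _)) => //; apply: (@sg_sgnz _ (wd_piece _ _)).
- split; last by rewrite linearD /= dB addr0.
  exact: (@sgD _ (wd_piece _ _)).
rewrite (coh_mul_cls q_assoc m_assocr) // (coh_mul_cls erefl m_assocl) //.
have Zr := wd_cocycleM q_assoc m_assocr Z1A ZB.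
have Zl := wd_cocycleM erefl m_assocl ZB' Z3A.
rewrite (clsD _ Zr Zl) (clsD _ ZU (sgD Zr Zl)).
congr cls; rewrite /massey_cochain mulrDr mulrDl mulrDr -[sg _ * B' * A3]mulrA sgK.
by rewrite addrACA.
Qed.

Section BracketOfClasses.
Variables (a1 : coh A q1 m1) (a2 : coh A q2 m2) (a3 : coh A q3 m3).

(** A product of classes vanishes exactly when the product of representatives is
a coboundary, so the hypotheses on a1 a2 and a2 a3 provide a defining system
on the canonical representatives. *)
Lemma left_null_ex :
  coh_mul (q := q1 + q2) (m := m1 + m2) a1 a2 = 0 ->
  exists U, left_null (rep a1) (rep a2) U.
Proof.
have Z := wd_cocycleM erefl erefl (rep_in a1) (rep_in a2).
by move=> /(cls_eq0 _ Z)[U gU dU]; exists U.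
Qed.

Lemma right_null_ex :
  coh_mul (q := q2 + q3) (m := m2 + m3) a2 a3 = 0 ->
  exists U', right_null (rep a2) (rep a3) U'.
Proof.
have Z := wd_cocycleM erefl erefl (rep_in a2) (rep_in a3).
by move=> /(cls_eq0 _ Z)[U gU dU]; exists U.
Qed.

(** Each representative differs from the canonical one by a coboundary; the three
are exchanged one after the other. *)
Lemma mor_bracket_rep :
  mor_bracket a1 a2 a3 = massey_classes (rep a1) (rep a2) (rep a3).
Proof.
have [Z1r Z2r Z3r] := And3 (rep_in a1) (rep_in a2) (rep_in a3).
apply/seteqP; split=> [c|_ [U [U' [nU nU' ->]]]]; last first.
  by exists (rep a1), (rep a2), (rep a3), U, U'; rewrite !repK.
have homologous q m (a : coh A q m) x : wd_cocycle A q m x -> cls x = a ->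
    exists2 E, gr q (m - 1) E & x = rep a + d E.
  move=> Zx; rewrite -[a in _ = a]repK => /(cls_eqP _ Zx (rep_in a))[E gE dE].
  by exists E; rewrite // dE addrC subrK.
case=> [A1 [A2 [A3 [U [U' [[Z1A e1] [Z2A e2] [Z3A e3] [nU nU'] ->]]]]]].
have [E1 gE1 defA1] := homologous _ _ _ _ Z1A e1.
have [E2 gE2 defA2] := homologous _ _ _ _ Z2A e2.
have [E3 gE3 defA3] := homologous _ _ _ _ Z3A e3.
(* Read from the last line up: the first factor is exchanged while the two
   others are still arbitrary. *)
apply: (massey_classes3 Z1r Z2r Z3r gE3); rewrite -defA3.
apply: (massey_classes2 Z1r Z2r Z3A gE2); rewrite -defA2.
apply: (massey_classes1 Z1r Z2A Z3A gE1); rewrite -defA1.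
by exists U, U'.
Qed.

Lemma mor_indeterminacy_subgroup :
  is_subgroup (mor_indeterminacy q2 m2 a1 a3).
Proof.
have q_assoc : (q1 + q2 + q3 = q1 + (q2 + q3))%N by lia.
have m_assocl : m1 + m2 + m3 - 1 = m1 + m2 - 1 + m3 by lia.
have m_assocr : m1 + m2 + m3 - 1 = m1 + (m2 + m3 - 1) by lia.
split=> [|_ _ [b [b' ->]] [c [c' ->]]].
  exists (0 - 0), (0 - 0).
  by rewrite (coh_mulBr q_assoc m_assocr) (coh_mulBl erefl m_assocl) !subrr addr0.
exists (b - c), (b' - c').
rewrite (coh_mulBr q_assoc m_assocr) (coh_mulBl erefl m_assocl).
by rewrite [RHS]addrACA opprD.
Qed.

Lemma mor_bracket_coset :
  coh_mul (q := q1 + q2) (m := m1 + m2) a1 a2 = 0 ->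
  coh_mul (q := q2 + q3) (m := m2 + m3) a2 a3 = 0 ->
  is_coset (mor_indeterminacy q2 m2 a1 a3) (mor_bracket a1 a2 a3).
Proof.
move=> /left_null_ex[U nU] /right_null_ex[U' nU'].
split; first exact: mor_indeterminacy_subgroup.
exists (cls (massey_cochain (rep a1) (rep a3) U U')).
rewrite mor_bracket_rep (massey_coset (rep_in a1) (rep_in a3) nU nU').
by rewrite !repK.
Qed.

End BracketOfClasses.
End Triple.
End Brackets.

(** * Naturality of the bracket *)

Section Naturality.
Variables (K : comNzRingType) (A B : wdga K) (f : A -> B).
Hypothesis fP : is_wdga_map f.

Lemma wdga_mapD (x y : A) : f (x + y) = f x + f y.
Proof. by case: fP => fl _ _ _; have := fl 1 x y; rewrite !scale1r. Qed.

Lemma wdga_map0 : f 0 = 0.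
Proof. by apply: (addrI (f 0)); rewrite -wdga_mapD !addr0. Qed.

Lemma wdga_mapN (x : A) : f (- x) = - f x.
Proof. by apply: (addrI (f x)); rewrite -wdga_mapD !subrr wdga_map0. Qed.

Lemma wdga_mapM (x y : A) : f (x * y) = f x * f y.
Proof. by case: fP => _ [_ fM] _ _; exact: fM. Qed.

Lemma wdga_map_sg (m : int) (x : A) : f (sgnz A m * x) = sgnz B m * f x.
Proof.
rewrite -[sgnz A m]signr_odd -[sgnz B m]signr_odd !mulr_sign.
by case: (odd _); rewrite ?wdga_mapN.
Qed.

Lemma wdga_map_cocycle (q : nat) (m : int) (x : A) :
  wd_cocycle A q m x -> wd_cocycle B q m (f x).
Proof.
by case: fP => _ _ fgr fd [gx dx]; split; [exact: fgr|rewrite -fd dx wdga_map0].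
Qed.

Lemma coh_map_cls (q : nat) (m : int) (x : A) : wd_cocycle A q m x ->
  coh_map f (cls x : coh A q m) = cls (f x).
Proof.
move=> Zx; apply: cls_eq; [exact: wdga_map_cocycle (rep_in _)|exact: wdga_map_cocycle|].
have [E gE dE] := rep_cls (wd_cobound A q m) Zx.
by case: fP => _ _ fgr fd; exists (f E); [exact: fgr|rewrite -fd dE wdga_mapD wdga_mapN].
Qed.

Lemma mor_bracket_natural (q1 q2 q3 : nat) (m1 m2 m3 : int)
    (a1 : coh A q1 m1) (a2 : coh A q2 m2) (a3 : coh A q3 m3) :
  coh_map f @` mor_bracket a1 a2 a3 `<=`
  mor_bracket (coh_map f a1) (coh_map f a2) (coh_map f a3).
Proof.
case: fP => _ _ fgr fd.
move=> _ [_ [A1 [A2 [A3 [U [U' [[Z1 <-] [Z2 <-] [Z3 <-] [nU nU'] ->]]]]]] <-].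
rewrite !coh_map_cls //; last exact: (massey_cocycle Z1 Z3 nU nU').
case: nU nU' => [gU dU] [gU' dU'].
exists (f A1), (f A2), (f A3), (f U), (f U'); split.
- by split=> //; exact: wdga_map_cocycle.
- by split=> //; exact: wdga_map_cocycle.
- by split=> //; exact: wdga_map_cocycle.
- by split; split; rewrite -?fd -?wdga_mapM ?dU ?dU' //; exact: fgr.
by rewrite wdga_mapD wdga_map_sg !wdga_mapM.
Qed.

End Naturality.

(** * Classes at equal but not convertible indices *)

Section Reindexing.
Variables (K : comNzRingType) (A : wdga K).

(** Meaningful for q = q' and m = m', when it is the transport along these
equalities. *)
Definition reindex q m q' m' (a : coh A q m) : coh A q' m' := cls (rep a).

Lemma rep_inj q m (a a' : coh A q m) : rep a = rep a' -> a = a'.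
Proof. by move=> e; rewrite -(repK a) e repK. Qed.

Lemma rep_cls_reindex q m q' m' (x : A) : q = q' -> m = m' ->
  rep (cls x : coh A q m) = rep (cls x : coh A q' m').
Proof. by move=> -> ->. Qed.

Lemma rep_reindex q m q' m' (a : coh A q m) : q = q' -> m = m' ->
  rep (reindex q' m' a) = rep a.
Proof. by move=> eq em; rewrite -(rep_cls_reindex _ eq em) repK. Qed.

Lemma coh_mul_reindex q1 m1 q2 m2 q m q1' m1' q2' m2' q' m'
    (a1 : coh A q1 m1) (a2 : coh A q2 m2)
    (a1' : coh A q1' m1') (a2' : coh A q2' m2') :
  q = q' -> m = m' -> rep a1 = rep a1' -> rep a2 = rep a2' ->
  rep (coh_mul a1 a2 : coh A q m) = rep (coh_mul a1' a2' : coh A q' m').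
Proof. by move=> eq em e1 e2; rewrite /coh_mul e1 e2; exact: rep_cls_reindex. Qed.

Lemma mor_bracket_reindex q1 m1 q2 m2 q3 m3 q1' m1' q2' m2' q3' m3'
    (a1 : coh A q1 m1) (a2 : coh A q2 m2) (a3 : coh A q3 m3)
    (a1' : coh A q1' m1') (a2' : coh A q2' m2') (a3' : coh A q3' m3') c c' :
  q1 = q1' -> m1 = m1' -> q2 = q2' -> m2 = m2' -> q3 = q3' -> m3 = m3' ->
  rep a1 = rep a1' -> rep a2 = rep a2' -> rep a3 = rep a3' -> rep c = rep c' ->
  mor_bracket a1 a2 a3 c -> mor_bracket a1' a2' a3' c'.
Proof.
move=> eq1 em1 eq2 em2 eq3 em3; subst.
by move=> /rep_inj-> /rep_inj-> /rep_inj-> /rep_inj->.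
Qed.

End Reindexing.

Lemma coh_map_reindex (K : comNzRingType) (A B : wdga K) (f : A -> B)
    q m q' m' (a : coh A q m) (a' : coh A q' m') :
  q = q' -> m = m' -> rep a = rep a' -> rep (coh_map f a) = rep (coh_map f a').
Proof. by move=> eq em e; rewrite /coh_map e; exact: rep_cls_reindex. Qed.

(** * Images of cosets under additive maps *)

Section Additive.
Variables (U V : zmodType) (f : U -> V).
Hypotheses (fB : zmod_morphism f).

Lemma zmod_morph0 : f 0 = 0.
Proof. by rewrite -[in LHS](subrr 0) fB subrr. Qed.

Lemma zmod_morphD x y : f (x + y) = f x + f y.
Proof.
have -> : x + y = x - (0 - y) by rewrite sub0r opprK.
by rewrite !fB zmod_morph0 sub0r opprK.
Qed.

Lemma coset_image (I S : set U) : is_coset I S -> is_coset (f @` I) (f @` S).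
Proof.
case=> [[I0 IB] [y ->]]; split; first split.
- by exists 0; rewrite ?zmod_morph0.
- by move=> _ _ [x Ix <-] [x' Ix' <-]; exists (x - x'); [exact: IB|exact: fB].
exists (f y); apply/seteqP; split=> [_ [_ [i Ii <-] <-]|_ [_ [i Ii <-] <-]].
  by exists (f i); rewrite ?zmod_morphD //; exists i.
by exists (y + i); rewrite ?zmod_morphD //; exists i.
Qed.

End Additive.

(** * Lawson products and brackets through duality *)

Section Duality.
Variables (R : realType) (K : comNzRingType) (M : morphic_model R K).
Variables (X : smooth_variety R) (D : duality_type M X).
Hypothesis hD : is_FL_duality D.
Local Notation n := ((sv_dim X)%:Z).
Local Notation L := (lawson (sv_set X) K).

Lemma duality_reindex q m q' m' p k (a : coh (M X) q m) (a' : coh (M X) q' m') :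
  q = q' -> m = m' -> rep a = rep a' -> @D q m p k a = @D q' m' p k a'.
Proof. by move=> eq em; subst=> /rep_inj->. Qed.

(** The bidegrees in which duality is an isomorphism; p >= 0 is the ordinary
Lawson range. *)
Definition dual_index (q : nat) (m p k : int) :=
  [/\ 0 <= p, p + q%:Z = n & k = n *+ 2 - m].

Lemma duality_iso q m p k : dual_index q m p k ->
  zmod_morphism (@D q m p k) /\ bijective (@D q m p k).
Proof.
case: p => p [] // _ epq ek.
by have [|] := hD (q := q) (p := p) (m := m) (k := k) _ ek; first lia.
Qed.

Lemma dual_index_co p k : 0 <= p <= n -> dual_index (cowt X p) (codeg X k) p k.
Proof. by move=> hp; split; rewrite /cowt /codeg; lia. Qed.

(** The Lawson index determines the cohomological one; hence every class below
can be moved to the index at which [Dinv] takes its values. *)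
Lemma dual_index_uniq q m p k : dual_index q m p k ->
  q = cowt X p /\ m = codeg X k.
Proof. by case=> hp epq ek; split; rewrite /cowt /codeg; lia. Qed.

Lemma DinvK p k (x : L p k) : 0 <= p <= n -> D p k (Dinv D x) = x.
Proof.
move=> /(dual_index_co k)/duality_iso[_ [g _ gK]].
exact: (@xgetPex _ _ [set a | D p k a = x] (ex_intro _ (g x) (gK x))).
Qed.

(** Left inverse property of [Dinv], stated on representatives since the index
(q, m) is only provably the one at which [Dinv] lands. *)
Lemma rep_Dinv_D q m p k (a : coh (M X) q m) : dual_index q m p k ->
  rep (Dinv D (@D q m p k a)) = rep a.
Proof.
move=> hi; have [eq em] := dual_index_uniq hi.
have hp : 0 <= p <= n by case: hi => *; lia.
rewrite -(rep_reindex a eq em); congr rep.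
have [_ /bij_inj inj] := duality_iso (dual_index_co k hp).
apply: inj; rewrite DinvK //; apply: duality_reindex => //.
by rewrite rep_reindex.
Qed.

(** Injectivity of duality turns a vanishing Lawson product into a vanishing
product in morphic cohomology. *)
Lemma bullet_eq0 p1 k1 p2 k2 (x1 : L p1 k1) (x2 : L p2 k2) :
  0 <= p1 <= n -> 0 <= p2 <= n -> 0 <= p1 + p2 - n ->
  bullet D (p := p1 + p2 - n) (k := k1 + k2 - n *+ 2) x1 x2 = 0 ->
  coh_mul (q := cowt X p1 + cowt X p2) (m := codeg X k1 + codeg X k2)
    (Dinv D x1) (Dinv D x2) = 0.
Proof.
move=> hp1 hp2 hp; rewrite /bullet.
have hi : dual_index (cowt X p1 + cowt X p2) (codeg X k1 + codeg X k2)
            (p1 + p2 - n) (k1 + k2 - n *+ 2).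
  by split; rewrite /cowt /codeg; lia.
have [DB /bij_inj inj] := duality_iso hi.
by rewrite -(zmod_morph0 DB) => /inj.
Qed.

Section TripleProduct.
Variables (p1 p2 p3 k1 k2 k3 : int).
Hypotheses (hp1 : 0 <= p1 <= n) (hp2 : 0 <= p2 <= n) (hp3 : 0 <= p3 <= n).
Variables (x1 : L p1 k1) (x2 : L p2 k2) (x3 : L p3 k3).
Hypotheses (hp : 0 <= p1 + p2 + p3 - n *+ 2).

Lemma dual_index_triple :
  dual_index (cowt X p1 + cowt X p2 + cowt X p3)
    (codeg X k1 + codeg X k2 + codeg X k3 - 1)
    (p1 + p2 + p3 - n *+ 2) (k1 + k2 + k3 - n *+ 4 + 1).
Proof. by split; rewrite /cowt /codeg; lia. Qed.

(** Duality is onto in the bidegrees of both auxiliary factors, so letting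
y and y' run over Lawson groups is the same as letting b and b' run over
morphic cohomology. *)
Lemma lawson_indeterminacyE : 0 <= p2 + p3 - n -> 0 <= p1 + p2 - n ->
  lawson_indeterminacy D p2 k2 x1 x3 =
  @D _ _ _ _ @` mor_indeterminacy (cowt X p2) (codeg X k2) (Dinv D x1) (Dinv D x3).
Proof.
move=> hp23 hp12; have [DB _] := duality_iso dual_index_triple.
have hi23 : dual_index (cowt X p2 + cowt X p3) (codeg X k2 + codeg X k3 - 1)
              (p2 + p3 - n) (k2 + k3 - n *+ 2 + 1).
  by split; rewrite /cowt /codeg; lia.
have hi12 : dual_index (cowt X p1 + cowt X p2) (codeg X k1 + codeg X k2 - 1)
              (p1 + p2 - n) (k1 + k2 - n *+ 2 + 1).
  by split; rewrite /cowt /codeg; lia.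
have bulletE (y : L (p2 + p3 - n) (k2 + k3 - n *+ 2 + 1))
    (y' : L (p1 + p2 - n) (k1 + k2 - n *+ 2 + 1))
    (b : coh (M X) (cowt X p2 + cowt X p3) (codeg X k2 + codeg X k3 - 1))
    (b' : coh (M X) (cowt X p1 + cowt X p2) (codeg X k1 + codeg X k2 - 1)) :
    rep (Dinv D y) = rep b -> rep (Dinv D y') = rep b' ->
    bullet D x1 y + bullet D y' x3 =
    D (p1 + p2 + p3 - n *+ 2) (k1 + k2 + k3 - n *+ 4 + 1)
      ((coh_mul (Dinv D x1) b + coh_mul b' (Dinv D x3))
       : coh (M X) (cowt X p1 + cowt X p2 + cowt X p3)
                   (codeg X k1 + codeg X k2 + codeg X k3 - 1)).
  move=> eb eb'; rewrite (zmod_morphD DB) /bullet; congr (_ + _).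
    by apply: duality_reindex; last apply: coh_mul_reindex; rewrite // /cowt /codeg; lia.
  by apply: duality_reindex; last apply: coh_mul_reindex; rewrite // /cowt /codeg; lia.
apply/seteqP; split=> [_ [y [y' ->]]|_ [_ [b [b' ->]] <-]].
  have [[e1 e2] [e3 e4]] := (dual_index_uniq hi23, dual_index_uniq hi12).
  pose b := reindex (cowt X p2 + cowt X p3) (codeg X k2 + codeg X k3 - 1) (Dinv D y).
  pose b' := reindex (cowt X p1 + cowt X p2) (codeg X k1 + codeg X k2 - 1) (Dinv D y').
  exists (coh_mul (Dinv D x1) b + coh_mul b' (Dinv D x3)); first by exists b, b'.
  by rewrite (bulletE y y' b b') // rep_reindex.
exists (@D _ _ _ _ b), (@D _ _ _ _ b').
by rewrite (bulletE _ _ b b') // rep_Dinv_D.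
Qed.

Lemma lawson_bracket_coset : 0 <= p2 + p3 - n -> 0 <= p1 + p2 - n ->
  bullet D (p := p1 + p2 - n) (k := k1 + k2 - n *+ 2) x1 x2 = 0 ->
  bullet D (p := p2 + p3 - n) (k := k2 + k3 - n *+ 2) x2 x3 = 0 ->
  is_coset (lawson_indeterminacy D p2 k2 x1 x3) (lawson_bracket D x1 x2 x3).
Proof.
move=> hp23 hp12 /(bullet_eq0 hp1 hp2 hp12) x12 /(bullet_eq0 hp2 hp3 hp23) x23.
rewrite lawson_indeterminacyE //; apply: coset_image.
  by case: (duality_iso dual_index_triple).
exact: mor_bracket_coset.
Qed.

End TripleProduct.
End Duality.

(** * Naturality of the Lawson bracket *)

Section LawsonNaturality.
Variables (R : realType) (K : comNzRingType) (M : morphic_model R K).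
Variables (X Y : smooth_variety R) (DX : duality_type M X) (DY : duality_type M Y).
Hypotheses (hDX : is_FL_duality DX) (hDY : is_FL_duality DY).
Variable f : vec R (sv_ambient Y) -> vec R (sv_ambient X).
Hypothesis fP : is_morphism f.
Local Notation n := ((sv_dim X)%:Z).
Local Notation L := (lawson (sv_set X) K).
Local Notation e := ((sv_dim Y)%:Z - n).

(** Pullback preserves codimension: p + e has in Y the codimension that p has
in X, so undoing duality on Y leaves the morphic pullback. *)
Lemma rep_Dinv_lawson_pull p k (x : L p k) : 0 <= p <= n -> 0 <= p + e ->
  rep (Dinv DY (lawson_pull DX DY f (p + e) (k + e *+ 2) x)) =
  rep (coh_map (mm_pull M f) (Dinv DX x)).
Proof. by move=> hp hpe; apply: rep_Dinv_D => //; split; rewrite /cowt /codeg; lia. Qed.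

(** The hypothesis that the last index stays nonnegative on Y also makes each
p_i + e nonnegative, because p_j <= n for the other two factors. *)
Lemma lawson_bracket_natural (p1 p2 p3 k1 k2 k3 : int)
    (x1 : L p1 k1) (x2 : L p2 k2) (x3 : L p3 k3) :
  0 <= p1 <= n -> 0 <= p2 <= n -> 0 <= p3 <= n ->
  0 <= p1 + p2 + p3 - n *+ 2 -> 0 <= p1 + p2 + p3 - n *+ 2 + e ->
  lawson_pull DX DY f _ _ @` lawson_bracket DX x1 x2 x3 `<=`
  lawson_bracket DY (lawson_pull DX DY f (p1 + e) (k1 + e *+ 2) x1)
                    (lawson_pull DX DY f (p2 + e) (k2 + e *+ 2) x2)
                    (lawson_pull DX DY f (p3 + e) (k3 + e *+ 2) x3).
Proof.
move=> hp1 hp2 hp3 hp hpe _ [_ [c bc <-] <-].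
have bfc := mor_bracket_natural (mm_pullP M fP) (imageP _ bc).
pose q' := (cowt Y (p1 + e) + cowt Y (p2 + e) + cowt Y (p3 + e))%N.
pose m' := codeg Y (k1 + e *+ 2) + codeg Y (k2 + e *+ 2) + codeg Y (k3 + e *+ 2) - 1.
have eq : (cowt X p1 + cowt X p2 + cowt X p3 = q')%N by rewrite /q' /cowt; lia.
have em : codeg X k1 + codeg X k2 + codeg X k3 - 1 = m' by rewrite /m' /codeg; lia.
have hi := dual_index_triple k1 k2 k3 hp1 hp2 hp3 hp.
have [eqX emX] := dual_index_uniq hi.
exists (reindex q' m' (coh_map (mm_pull M f) c)).
  apply: mor_bracket_reindex bfc; rewrite ?rep_Dinv_lawson_pull ?rep_reindex //;
    rewrite /cowt /codeg; lia.
apply: duality_reindex; rewrite -?eq -?em // rep_reindex //.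
by apply: coh_map_reindex; rewrite // rep_Dinv_D.
Qed.

End LawsonNaturality.

Theorem theorem1p1 (R : realType) (c : coefficients)
    (M : morphic_model R (coef_ring R c))
    (X : smooth_variety R) (n : int) (hX : projective X) (hn : n = (sv_dim X)%:Z)
    (D : duality_type M X) (hD : is_FL_duality D)
    (p1 p2 p3 k1 k2 k3 : int)
    (hp1 : 0 <= p1 <= n) (hp2 : 0 <= p2 <= n) (hp3 : 0 <= p3 <= n)
    (hk1 : p1 *+ 2 <= k1) (hk2 : p2 *+ 2 <= k2) (hk3 : p3 *+ 2 <= k3)
    (x1 : lawson (sv_set X) (coef_ring R c) p1 k1)
    (x2 : lawson (sv_set X) (coef_ring R c) p2 k2)
    (x3 : lawson (sv_set X) (coef_ring R c) p3 k3) :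
  [/\ 0 <= p1 + p2 + p3 - n *+ 2 -> 0 <= p2 + p3 - n -> 0 <= p1 + p2 - n ->
      bullet D (p := p1 + p2 - n) (k := k1 + k2 - n *+ 2) x1 x2 = 0 ->
      bullet D (p := p2 + p3 - n) (k := k2 + k3 - n *+ 2) x2 x3 = 0 ->
      is_coset (lawson_indeterminacy D p2 k2 x1 x3) (lawson_bracket D x1 x2 x3),
      forall (Y : smooth_variety R) (DY : duality_type M Y)
             (f : vec R (sv_ambient Y) -> vec R (sv_ambient X)) (e : int),
        projective Y -> is_FL_duality DY -> is_morphism f ->
        e = (sv_dim Y)%:Z - n ->
        0 <= p1 + p2 + p3 - n *+ 2 -> 0 <= p2 + p3 - n -> 0 <= p1 + p2 - n ->
        0 <= p1 + p2 + p3 - n *+ 2 + e ->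
        bullet D (p := p1 + p2 - n) (k := k1 + k2 - n *+ 2) x1 x2 = 0 ->
        bullet D (p := p2 + p3 - n) (k := k2 + k3 - n *+ 2) x2 x3 = 0 ->
        lawson_pull D DY f _ _ @` lawson_bracket D x1 x2 x3 `<=`
        lawson_bracket DY (lawson_pull D DY f (p1 + e) (k1 + e *+ 2) x1)
                          (lawson_pull D DY f (p2 + e) (k2 + e *+ 2) x2)
                          (lawson_pull D DY f (p3 + e) (k3 + e *+ 2) x3),
      coh_mul (q := cowt X p1 + cowt X p2) (m := codeg X k1 + codeg X k2)
        (Dinv D x1) (Dinv D x2) = 0 ->
      coh_mul (q := cowt X p2 + cowt X p3) (m := codeg X k2 + codeg X k3)
        (Dinv D x2) (Dinv D x3) = 0 ->
      is_coset (mor_indeterminacy (cowt X p2) (codeg X k2) (Dinv D x1) (Dinv D x3))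
               (mor_bracket (Dinv D x1) (Dinv D x2) (Dinv D x3)),
      forall (A B : wdga (coef_ring R c)) (f : A -> B), is_wdga_map f ->
        forall (q1 q2 q3 : nat) (m1 m2 m3 : int)
               (a1 : coh A q1 m1) (a2 : coh A q2 m2) (a3 : coh A q3 m3),
        coh_mul (q := q1 + q2) (m := m1 + m2) a1 a2 = 0 ->
        coh_mul (q := q2 + q3) (m := m2 + m3) a2 a3 = 0 ->
        coh_map f @` mor_bracket a1 a2 a3 `<=`
        mor_bracket (coh_map f a1) (coh_map f a2) (coh_map f a3) &
      forall (V W : smooth_variety R)
             (f : vec R (sv_ambient V) -> vec R (sv_ambient W)), is_morphism f ->
        forall (q1 q2 q3 : nat) (m1 m2 m3 : int)
               (a1 : coh (M W) q1 m1) (a2 : coh (M W) q2 m2) (a3 : coh (M W) q3 m3),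
        coh_mul (q := q1 + q2) (m := m1 + m2) a1 a2 = 0 ->
        coh_mul (q := q2 + q3) (m := m2 + m3) a2 a3 = 0 ->
        coh_map (mm_pull M f) @` mor_bracket a1 a2 a3 `<=`
        mor_bracket (coh_map (mm_pull M f) a1) (coh_map (mm_pull M f) a2)
                    (coh_map (mm_pull M f) a3)].
Proof.
subst n; split=> [hp hp23 hp12 x12 x23|Y DY f e _ hDY fP -> hp _ _ hpe _ _|||].
- exact: lawson_bracket_coset.
- exact: lawson_bracket_natural.
- exact: mor_bracket_coset.
- by move=> A B f fP *; exact: mor_bracket_natural.
by move=> V W f fP *; exact: (mor_bracket_natural (mm_pullP M fP)).
Qed.
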